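(* Let $f:A\to B$ be a ring homomorphism and let $J$ be an ideal of $B$. Assume that $A$ is local with finitely generated maximal ideal $M$, that $J$ is finitely generated as an ideal of the ring $f(A)+J$, and that $J$ is contained in the Jacobson radical of $B$. Then the ring $A\bowtie^f J$ is local with finitely generated maximal ideal and moreover $$\mathrm{embdim}(A\bowtie^f J)=\mathrm{embdim}(A)+\nu(J),$$ where $\nu(J)$ denotes the minimum number of generators of $J$ as an ideal of the ring $f(A)+J$.
   Context: All rings are commutative with unity; ''local'' means having exactly one maximal ideal. $A\bowtie^f J:=\{(a,f(a)+j)\mid a\in A,\ j\in J\}$ is a subring of $A\times B$, and $f(A)+J=\{f(a)+j\mid a\in A,\ j\in J\}$ is a subring of $B$. For a local ring $R$ with finitely generated maximal ideal $N$, $\mathrm{embdim}(R)$ is the minimum number of generators of $N$, i.e. $\dim_{R/N}(N/N^2)$. *)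

(* Defs.v *)
From HB Require Import structures.
From mathcomp Require Import all_boot all_order all_algebra.
From mathcomp Require Import all_classical.

Set Implicit Arguments.
Unset Strict Implicit.
Unset Printing Implicit Defensive.

Import GRing.Theory.
Local Open Scope classical_set_scope.
Local Open Scope ring_scope.

(* Rings are comPzRingType, so the zero ring is allowed. The idealr structure *)
(* of ring_quotient is not used: it only covers proper ideals of nonzero rings. *)
Section Ideals.
Variable R : comPzRingType.
Implicit Types I M : set R.

Definition is_ideal I : Prop :=
  [/\ I 0, (forall x y, I x -> I y -> I (x + y)) &
      (forall a x, I x -> I (a * x))].

Record ideal := Ideal { ideal_set :> set R; idealP : is_ideal ideal_set }.

Definition maximal_ideal M : Prop :=
  [/\ is_ideal M, M <> setT &
      forall I, is_ideal I -> M `<=` I -> I = M \/ I = setT].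

Definition local_ring : Prop := exists! M, maximal_ideal M.

(* "The" maximal ideal, meaningful only when R is local. *)
Definition the_maximal_ideal : set R := get [set M | maximal_ideal M].

Definition jacobson_radical : set R :=
  [set x | forall M, maximal_ideal M -> M x].

Definition ideal_generated_by n (g : 'I_n -> R) : set R :=
  [set x | exists c : 'I_n -> R, x = \sum_(i < n) c i * g i].

Definition has_generators I n : Prop :=
  exists g : 'I_n -> R, I = ideal_generated_by g.

Definition finitely_generated I : Prop := exists n, has_generators I n.

(* The value is 0 by convention when I is not finitely generated. *)
Definition min_generators I : nat :=
  xget 0%N [set n | has_generators I n /\
                    forall m, has_generators I m -> (n <= m)%N].

Lemma min_generatorsP I : finitely_generated I ->
  has_generators I (min_generators I) /\
  forall m, has_generators I m -> (min_generators I <= m)%N.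
Proof.
move=> [n In]; apply: (@xgetPex _ 0%N [set n | has_generators I n /\
  forall m, has_generators I m -> (n <= m)%N]).
have ex : exists n, `[< has_generators I n >] by exists n; apply/asboolP.
case: (ex_minnP ex) => m /asboolP Im mmin.
by exists m; split=> // k Ik; apply: mmin; apply/asboolP.
Qed.

Lemma the_maximal_idealP : local_ring ->
  forall M, maximal_ideal M <-> M = the_maximal_ideal.
Proof.
move=> [M0 [max0 uniq0]] M.
have maxE : maximal_ideal the_maximal_ideal.
  by apply: (@getPex _ [set M | maximal_ideal M]); exists M0.
split=> [maxM|->//].
by rewrite -(uniq0 _ maxM) -(uniq0 _ maxE).
Qed.

End Ideals.

Arguments jacobson_radical : clear implicits.
Arguments local_ring : clear implicits.
Arguments the_maximal_ideal : clear implicits.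

Definition embdim (R : comPzRingType) : nat :=
  min_generators (the_maximal_ideal R).

Section Amalgamation.
Variables (A B : comPzRingType) (f : {rmorphism A -> B}) (J : ideal B).

Definition amalg_set : set (A * B)%type :=
  [set x | exists a j, (J : set B) j /\ x = (a, f a + j)].

Definition image_add_set : set B :=
  [set b | exists a j, (J : set B) j /\ b = f a + j].

Definition amalg_pred : {pred (A * B)%type} := mem amalg_set.
Definition image_add_pred : {pred B} := mem image_add_set.

Let J0 : (J : set B) 0. Proof. by case: (idealP J). Qed.
Let JD x y : (J : set B) x -> (J : set B) y -> (J : set B) (x + y).
Proof. by case: (idealP J) => _ + _; apply. Qed.
Let JM a x : (J : set B) x -> (J : set B) (a * x).
Proof. by case: (idealP J) => _ _; apply. Qed.
Let JB x y : (J : set B) x -> (J : set B) y -> (J : set B) (x - y).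
Proof. by move=> Jx Jy; rewrite -mulN1r; apply/JD/JM. Qed.

Let prodD a j a' j' : (J : set B) j -> (J : set B) j' ->
  exists2 k, (J : set B) k & (f a + j) * (f a' + j') = f (a * a') + k.
Proof.
move=> Jj Jj'; exists (f a * j' + j * (f a' + j')).
  by apply: JD; [exact: JM | rewrite mulrC; exact: JM].
by rewrite rmorphM mulrDl mulrDr addrA.
Qed.

Lemma amalg_subring_closed : subring_closed amalg_pred.
Proof.
split=> [|x y|x y].
- by apply/mem_set; exists 1, 0; rewrite rmorph1 addr0; split=> //; exact: J0.
- move=> /set_mem [a [j [Jj ->]]] /set_mem [b [k [Jk ->]]]; apply/mem_set.
  exists (a - b), (j - k); split; first exact: JB.
  by congr pair => /=; rewrite rmorphB opprD addrACA.
- move=> /set_mem [a [j [Jj ->]]] /set_mem [b [k [Jk ->]]]; apply/mem_set.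
  have [l Jl E] := prodD a b Jj Jk.
  by exists (a * b), l; split=> //; congr pair.
Qed.

Lemma image_add_subring_closed : subring_closed image_add_pred.
Proof.
split=> [|x y|x y].
- by apply/mem_set; exists 1, 0; rewrite rmorph1 addr0; split=> //; exact: J0.
- move=> /set_mem [a [j [Jj ->]]] /set_mem [b [k [Jk ->]]]; apply/mem_set.
  exists (a - b), (j - k); split; first exact: JB.
  by rewrite rmorphB opprD addrACA.
- move=> /set_mem [a [j [Jj ->]]] /set_mem [b [k [Jk ->]]]; apply/mem_set.
  by have [l Jl E] := prodD a b Jj Jk; exists (a * b), l.
Qed.

Record amalg : Type :=
  Amalg { amalg_val :> (A * B)%type; _ : amalg_val \in amalg_pred }.

HB.instance Definition _ := [isSub for amalg_val].
HB.instance Definition _ := [Choice of amalg by <:].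
HB.instance Definition _ :=
  GRing.SubChoice_isSubComPzRing.Build _ _ amalg amalg_subring_closed.

Record image_add : Type :=
  ImageAdd { image_add_val :> B; _ : image_add_val \in image_add_pred }.

HB.instance Definition _ := [isSub for image_add_val].
HB.instance Definition _ := [Choice of image_add by <:].
HB.instance Definition _ :=
  GRing.SubChoice_isSubComPzRing.Build _ _ image_add image_add_subring_closed.

(* J regarded as an ideal of f(A) + J. *)
Definition ideal_in_image_add : set image_add :=
  [set x | (J : set B) (image_add_val x)].

End Amalgamation.

Arguments ideal_in_image_add {A B} f J.

(* Main.v *)
Require Import Defs.
From HB Require Import structures.
From mathcomp Require Import all_boot all_order all_algebra.
From mathcomp Require Import all_classical.

(** The projection of the amalgamation R onto A is split by the ring morphism
    a |-> (a, f a), and its kernel L = 0 x J satisfies 1 + L <= R^*, because J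
    lies in the Jacobson radical of B.  The proof uses only these two facts
    about R; the link with the ring f(A) + J is that the second projection
    R -> f(A) + J is onto and carries L bijectively to J, so that L and J have
    families of generators of the same sizes ([has_generators_transport]).

    Let p : R -> A be a ring morphism with section s, with A local of maximal
    ideal M, and with 1 + l invertible for all l in L = ker p.  If p x is
    invertible then so is x, since x times the lift of (p x)^-1 lies in 1 + L.
    Hence R is local with maximal ideal N = p^-1(M) ([split_local]).

    As N = s(M) + L, lifting generators of M by s and adjoining generators of L
    gives generators of N, whence embdim R <= embdim A + nu(L)
    ([split_generators]).  Conversely ([split_generators_ge]), let g_1, ..., g_n
    generate N.  Their images generate M; keep a subset S of the indices whose
    images still generate M and which is as small as possible, so that a
    relation between these images has no invertible coefficient.  For i outside
    S, correct g_i by a combination of the g_k, k in S, into an element g'_i of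
    L.  An element l of L is then a combination of the g'_i plus
    sum_(k in S) e_k g_k, where sum_(k in S) p(e_k) p(g_k) = 0.  Thus all p(e_k)
    lie in M, and a rewriting with s shows that sum_(k in S) e_k g_k lies in
    N L.  By Nakayama's lemma the g'_i generate L, so
    n = #|S| + #|~: S| >= embdim A + nu(L).  Choosing S of minimal size replaces
    the comparison of dimensions of M/M^2, N/N^2 and L/NL over the residue
    field. *)

Set Implicit Arguments.
Unset Strict Implicit.
Unset Printing Implicit Defensive.

Import GRing.Theory.
Local Open Scope classical_set_scope.
Local Open Scope ring_scope.

(** * Ideals, invertible elements and local rings *)

Section IdealTheory.
Variable R : comPzRingType.
Implicit Types (I H Q M N : set R) (x y : R).

Definition invertible x : Prop := exists y, x * y = 1.

Lemma ideal0 I : is_ideal I -> I 0. Proof. by case. Qed.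

Lemma idealD I x y : is_ideal I -> I x -> I y -> I (x + y).
Proof. by case=> _ + _; apply. Qed.

Lemma idealMl I a x : is_ideal I -> I x -> I (a * x).
Proof. by case=> _ _; apply. Qed.

Lemma idealMr I a x : is_ideal I -> I x -> I (x * a).
Proof. by move=> idI Ix; rewrite mulrC; apply: idealMl. Qed.

Lemma idealN I x : is_ideal I -> I x -> I (- x).
Proof. by move=> idI Ix; rewrite -mulN1r; apply: idealMl. Qed.

Lemma idealB I x y : is_ideal I -> I x -> I y -> I (x - y).
Proof. by move=> idI Ix Iy; apply: idealD => //; apply: idealN. Qed.

Lemma ideal_sum I (T : finType) (P : pred T) (F : T -> R) :
  is_ideal I -> (forall i, P i -> I (F i)) -> I (\sum_(i | P i) F i).
Proof.
move=> idI IF; elim/big_ind: _ => //; first exact: ideal0.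
by move=> x y; apply: idealD.
Qed.

Lemma ideal1_setT I : is_ideal I -> I 1 -> I = setT.
Proof.
move=> idI I1; apply/seteqP; split=> // x _.
by rewrite -(mulr1 x); apply: idealMl.
Qed.

Lemma maximal_not1 M : maximal_ideal M -> ~ M 1.
Proof. by case=> idM Mn _ M1; apply/Mn/ideal1_setT. Qed.

(** Krull's theorem, from Zorn's lemma. *)
Lemma proper_ideal_sub_maximal I : is_ideal I -> ~ I 1 ->
  exists2 M, maximal_ideal M & I `<=` M.
Proof.
move=> idI I1.
(* Zorn's lemma for unions of chains includes the empty chain, whose union is
   empty; stating P for I `|` X makes I the bound of that chain. *)
pose P := [set X : set R | is_ideal (I `|` X) /\ ~ (I `|` X) 1].
have [F FP Ftot|X [[idX X1] Xmax]] := @Zorn_bigcup R P.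
  split; last by case=> // -[X FX X1]; have [_ []] := FP _ FX; right.
  split=> [|x y|a x]; first by left; apply: ideal0.
  - have sub X z : F X -> (I `|` X) z -> (I `|` \bigcup_(X in F) X) z.
      by move=> FX [Iz|Xz]; [left | right; exists X].
    move=> [Ix|[X FX Xx]] [Iy|[Y FY Yy]].
    + by left; apply: idealD.
    + apply: (sub Y) => //; have [idY _] := FP _ FY.
      by apply: idealD => //; [left | right].
    + apply: (sub X) => //; have [idX _] := FP _ FX.
      by apply: idealD => //; [right | left].
    + have [XY|YX] := Ftot _ _ FX FY.
      * apply: (sub Y) => //; have [idY _] := FP _ FY.
        by apply: idealD => //; right => //; apply: XY.
      * apply: (sub X) => //; have [idX _] := FP _ FX.
        by apply: idealD => //; right => //; apply: YX.
  - case=> [Ix|[X FX Xx]]; first by left; apply: idealMl.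
    have [idX _] := FP _ FX.
    have [Iax|Xax] : (I `|` X) (a * x) by apply: idealMl => //; right.
      by left.
    by right; exists X.
exists (I `|` X); last by move=> x; left.
split=> // [|K idK XK]; first by move=> XT; apply: X1; rewrite XT.
have [K1|K1] := pselect (K 1); first by right; apply: ideal1_setT.
left; apply/seteqP; split=> // x Kx; apply: contrapT => Xx.
have IK : I `|` K = K by apply/setUidPr => z Iz; apply: XK; left.
have XltK : X `<` K.
  split=> [z Xz|KX]; first by apply: XK; right.
  by apply: Xx; right; apply: KX.
by apply: (Xmax _ XltK); split; rewrite IK.
Qed.

Lemma invertible_outside_maximal x :
  (forall M, maximal_ideal M -> ~ M x) -> invertible x.
Proof.
move=> xM; apply: contrapT => xu.
have idx : is_ideal [set z | exists y, z = x * y].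
  split=> [|z t [y ->] [y' ->]|a z [y ->]].
  - by exists 0; rewrite mulr0.
  - by exists (y + y'); rewrite mulrDr.
  - by exists (a * y); rewrite mulrCA.
have [|M maxM xsM] := proper_ideal_sub_maximal idx.
  by move=> [y xy]; apply: xu; exists y.
by apply: (xM M) => //; apply: xsM; exists 1; rewrite mulr1.
Qed.

(** A maximal ideal containing 1 + x and x would contain 1. *)
Lemma jacobson_invertible x : jacobson_radical R x -> invertible (1 + x).
Proof.
move=> Jx; apply: invertible_outside_maximal => M maxM Mx.
apply: (maximal_not1 maxM); rewrite -(addrK x 1).
by have [idM _ _] := maxM; apply: idealB => //; apply: Jx.
Qed.

(** A proper ideal lies among the non-invertible elements, hence inside N. *)
Lemma local_of_nonunits N : is_ideal N -> ~ N 1 ->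
  (forall x, ~ N x -> invertible x) ->
  local_ring R /\ the_maximal_ideal R = N.
Proof.
move=> idN N1 Nu.
have sub K : is_ideal K -> ~ K 1 -> K `<=` N.
  move=> idK K1 x Kx; apply: contrapT => /Nu[y xy].
  by apply: K1; rewrite -xy; apply: idealMr.
have maxN : maximal_ideal N.
  split=> // [NT|K idK NK]; first by apply: N1; rewrite NT.
  have [K1|K1] := pselect (K 1); first by right; apply: ideal1_setT.
  by left; apply/seteqP; split=> //; apply: sub.
have locR : local_ring R.
  exists N; split=> // K maxK; have [idK _ Kmax] := maxK.
  have [|//|NT] := Kmax N idN; first exact/sub/maximal_not1.
  by case: N1; rewrite NT.
by split=> //; apply/esym/the_maximal_idealP.
Qed.

Lemma local_maximal : local_ring R -> maximal_ideal (the_maximal_ideal R).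
Proof. by move=> locR; apply/the_maximal_idealP. Qed.

Lemma local_invertible x : local_ring R ->
  ~ the_maximal_ideal R x -> invertible x.
Proof.
move=> locR Mx; apply: invertible_outside_maximal => M maxM.
by have /(_ M)[-> //] := the_maximal_idealP locR.
Qed.

(** * Generating families and Nakayama's lemma *)

Lemma min_generatorsE I n : has_generators I n ->
  (forall m, has_generators I m -> (n <= m)%N) -> min_generators I = n.
Proof.
move=> In nmin; have [Im mmin] := min_generatorsP (ex_intro _ n In).
by apply/eqP; rewrite eqn_leq mmin// nmin.
Qed.

Definition combinations (T : finType) (g : T -> R) (P : pred T) : set R :=
  [set x | exists c : T -> R, x = \sum_(i | P i) c i * g i].

(** Generation by a subfamily: indexing by a finite set S rather than by 'I_n
    lets generators be discarded without renumbering the others. *)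
Definition spanned I (T : finType) (g : T -> R) (S : {set T}) : Prop :=
  (forall i, i \in S -> I (g i)) /\ I `<=` combinations g (mem S).

Lemma combinations_is_ideal (T : finType) (g : T -> R) (P : pred T) :
  is_ideal (combinations g P).
Proof.
split=> [|x y [c ->] [d ->]|a x [c ->]].
- by exists (fun=> 0); rewrite big1// => i _; rewrite mul0r.
- exists (fun i => c i + d i); rewrite -big_split.
  by apply: eq_bigr => i _; rewrite mulrDl.
- exists (fun i => a * c i); rewrite mulr_sumr.
  by apply: eq_bigr => i _; rewrite mulrA.
Qed.

Lemma generated_is_ideal n (g : 'I_n -> R) : is_ideal (ideal_generated_by g).
Proof. exact: combinations_is_ideal. Qed.

Lemma generated_mem n (g : 'I_n -> R) i : ideal_generated_by g (g i).
Proof.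
exists (fun k => (k == i)%:R); rewrite (bigD1 i)//= eqxx mul1r big1 ?addr0//.
by move=> k /negbTE ->; rewrite mul0r.
Qed.

Lemma spanned_has_generators I (T : finType) (g : T -> R) (S : {set T}) :
  is_ideal I -> spanned I g S -> has_generators I #|S|.
Proof.
move=> idI [Ig gI]; exists (fun k => g (enum_val k)).
apply/seteqP; split=> [x /gI[c ->]|_ [c ->]].
  exists (fun k => c (enum_val k)).
  exact: (big_enum_val (fun i => c i * g i)).
by apply: ideal_sum => // k _; apply: idealMl => //; apply/Ig/enum_valP.
Qed.

Lemma has_generators_spanned I n : has_generators I n ->
  exists g : 'I_n -> R, spanned I g [set: _]%SET.
Proof.
move=> [g ->]; exists g; split=> [i _|x [c ->]]; first exact: generated_mem.
by exists c; apply: eq_bigl => i; rewrite /= finset.in_setT.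
Qed.

(** Take S of minimal size: an invertible coefficient in a relation would
    express one generator through the others, which could then be dropped.
    Over a local ring the coefficients of relations thus lie in the maximal
    ideal, which is what independence modulo that ideal would provide. *)
Lemma irredundant_subfamily I (T : finType) (g : T -> R) (S0 : {set T}) :
  spanned I g S0 ->
  exists2 S : {set T}, spanned I g S &
    forall c : T -> R, \sum_(i in S) c i * g i = 0 ->
    forall i, i \in S -> ~ invertible (c i).
Proof.
move=> gS0.
have [S /asboolP gS Smin] :=
  @arg_minnP _ S0 (fun S => `[< spanned I g S >]) (fun S => #|S|)
    (introT (asboolP _) gS0).
exists S => // c c0 i iS [u cu].
have /Smin : `[< spanned I g (S :\ i) >].
  apply/asboolP; case: gS => Ig gI; split=> [k|x /gI[d ->]].
    by rewrite in_setD1 => /andP[_]; apply: Ig.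
  exists (fun k => d k - d i * u * c k).
  move: c0; rewrite !(big_setD1 i iS)/= => c0.
  have gi : g i = - (u * \sum_(k in S :\ i) c k * g k).
    have -> : \sum_(k in S :\ i) c k * g k = - (c i * g i).
      by apply/eqP; rewrite -addr_eq0 addrC c0.
    by rewrite mulrN opprK mulrA (mulrC u) cu mul1r.
  rewrite {1}gi mulrN mulrA mulr_sumr addrC -sumrB.
  by apply: eq_bigr => k _; rewrite mulrBl mulrA.
by rewrite (cardsD1 i S) iS ltnn.
Qed.

(** Nakayama's lemma for I <= H + Q I, where H + Q I is described as the least
    ideal containing H and all products of elements of Q and I.  Generators of
    I modulo H are eliminated one by one: the last one is q times itself, with
    q in Q, plus a combination of the others modulo H, and 1 - q is
    invertible. *)
Lemma nakayama I H Q : is_ideal H -> is_ideal Q ->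
  (forall q, Q q -> invertible (1 - q)) ->
  finitely_generated I ->
  (forall K, is_ideal K -> H `<=` K ->
     (forall q y, Q q -> I y -> K (q * y)) -> I `<=` K) ->
  I `<=` H.
Proof.
move=> idH idQ Qu [n [g0 Ig0]] IHQ.
(* Generation modulo H is what survives when a generator is eliminated. *)
suff gen m (g : 'I_m -> R) : (forall i, I (g i)) ->
    (forall x, I x -> exists2 h, H h & ideal_generated_by g (x - h)) ->
    I `<=` H.
  apply: (gen n g0) => [i|x Ix]; first by rewrite Ig0; apply: generated_mem.
  by exists 0; [apply: ideal0 | rewrite subr0 -Ig0].
elim: m => [|m IHm] in g * => Ig gI.
  move=> x /gI[h Hh [c]]; rewrite big_ord0 => /eqP.
  by rewrite subr_eq0 => /eqP ->.
(* K is H + Q I, with elements of Q I written on the generators g. *)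
pose K := [set x | exists h (q : 'I_m.+1 -> R),
  [/\ H h, forall i, Q (q i) & x = h + \sum_i q i * g i]].
have idK : is_ideal K.
  split=> [|_ _ [h [q [Hh Qq ->]]] [h' [q' [Hh' Qq' ->]]]|a _ [h [q [Hh Qq ->]]]].
  - exists 0, (fun=> 0); split=> *; [exact: ideal0 | exact: ideal0 |].
    by rewrite big1 ?addr0// => i _; rewrite mul0r.
  - exists (h + h'), (fun i => q i + q' i); split=> *; [exact: idealD..|].
    by rewrite addrACA -big_split/=; congr +%R; apply: eq_bigr => i _; rewrite mulrDl.
  - exists (a * h), (fun i => a * q i); split=> *; [exact: idealMl..|].
    rewrite mulrDr mulr_sumr; congr +%R.
    by apply: eq_bigr => i _; rewrite mulrA.
have IK : I `<=` K.
  apply: IHQ => // [h Hh|q y Qq /gI[h Hh [c yE]]].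
    exists h, (fun=> 0); split=> // [i|]; first exact: ideal0.
    by rewrite big1 ?addr0// => i _; rewrite mul0r.
  exists (q * h), (fun i => q * c i); split=> *; [exact: idealMl|exact: idealMr|].
  rewrite -[y](subrK h) yE mulrDr addrC mulr_sumr; congr +%R.
  by apply: eq_bigr => i _; rewrite mulrA.
have [h [q [Hh Qq gE]]] := IK _ (Ig ord_max).
have [u qu] := Qu _ (Qq ord_max).
have {}gE : g ord_max =
    u * h + \sum_(i < m) u * q (widen_ord (leqnSn m) i) * g (widen_ord (leqnSn m) i).
  have : (1 - q ord_max) * g ord_max =
      h + \sum_(i < m) q (widen_ord (leqnSn m) i) * g (widen_ord (leqnSn m) i).
    by rewrite mulrBl mul1r {1}gE big_ord_recr/= addrA addrK.
  move/(congr1 ( *%R u)); rewrite mulrA (mulrC u) qu mul1r => ->.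
  by rewrite mulrDr mulr_sumr; congr +%R; apply: eq_bigr => i _; rewrite mulrA.
apply: (IHm (fun i => g (widen_ord (leqnSn m) i))) => // x /gI[h' Hh' [c xE]].
exists (h' + c ord_max * (u * h)); first by apply: idealD => //; do 2 apply: idealMl => //.
rewrite opprD addrA xE big_ord_recr/= gE mulrDr.
rewrite [c ord_max * (u * h) + _]addrC addrA addrK.
have idg := generated_is_ideal (fun i => g (widen_ord (leqnSn m) i)).
apply: (idealD idg); first by exists (fun i => c (widen_ord (leqnSn m) i)).
by apply: (idealMl _ idg); exists (fun i => u * q (widen_ord (leqnSn m) i)).
Qed.

End IdealTheory.

(** The kernel of q annihilates L, since q is injective on L.  So R acts on L
    through C, and q identifies the R-module L with the C-module K; generators
    and coefficients over C can be lifted. *)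
Lemma has_generators_transport (R C : comPzRingType) (q : {rmorphism R -> C})
    (L : set R) (K : set C) :
  (forall y, exists x, q x = y) -> is_ideal L ->
  K = q @` L -> (forall x, L x -> q x = 0 -> x = 0) ->
  forall n, has_generators L n <-> has_generators K n.
Proof.
move=> qsurj idL -> qinj n; split=> [[g LE]|[g KE]].
  exists (q \o g); apply/seteqP; split=> [_ [x + <-]|_ [c ->]].
    rewrite {1}LE => -[c ->]; exists (q \o c); rewrite rmorph_sum.
    by apply: eq_bigr => i _; rewrite rmorphM.
  have [d dE] := choice (fun i => qsurj (c i)).
  exists (\sum_i d i * g i); first by rewrite LE; exists d.
  by rewrite rmorph_sum; apply: eq_bigr => i _; rewrite rmorphM dE.
have gL i : exists x, L x /\ q x = g i.
  have : (q @` L) (g i) by rewrite KE; apply: generated_mem.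
  by move=> [x Lx qx]; exists x.
have {gL}[h hE] := choice gL.
exists h; apply/seteqP; split=> [x Lx|_ [c ->]]; last first.
  by apply: ideal_sum => // i _; apply: idealMl => //; have [] := hE i.
have : (q @` L) (q x) by exists x.
rewrite KE => -[c qx]; have [d dE] := choice (fun i => qsurj (c i)).
exists d; apply/eqP; rewrite -subr_eq0; apply/eqP/qinj.
  apply: idealB => //; apply: ideal_sum => // i _.
  by apply: idealMl => //; have [] := hE i.
rewrite rmorphB rmorph_sum qx; apply/eqP; rewrite subr_eq0; apply/eqP.
by apply: eq_bigr => i _; rewrite rmorphM dE; have [_ ->] := hE i.
Qed.

(** * Split extensions of a local ring *)

Lemma kernel_is_ideal (R A : comPzRingType) (p : {rmorphism R -> A}) :
  is_ideal [set x | p x = 0].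
Proof.
split=> [|x y|a x] /=; rewrite ?rmorph0// ?rmorphD ?rmorphM => -> //.
  by move=> ->; rewrite addr0.
by rewrite mulr0.
Qed.

Section SplitExtension.
Variables (A R : comPzRingType) (p : {rmorphism R -> A}) (s : {rmorphism A -> R}).
Hypothesis sK : cancel s p.
Let L : set R := [set x | p x = 0].
Hypothesis L_inv : forall x, L x -> invertible (1 + x).
Hypothesis A_local : local_ring A.
Let M := the_maximal_ideal A.
Let N : set R := p @^-1` M.

Let idM : is_ideal M. Proof. by case: (local_maximal A_local). Qed.

Let idL : is_ideal L. Proof. exact: kernel_is_ideal. Qed.

Let idN : is_ideal N.
Proof.
split=> [|x y|a x]; rewrite /N/= ?rmorph0 ?rmorphD ?rmorphM.
- exact: ideal0.
- exact: idealD.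
- exact: idealMl.
Qed.

Let LN : L `<=` N. Proof. by move=> x; rewrite /N/= => ->; apply: ideal0. Qed.

Let L_split x : L (x - s (p x)).
Proof. by rewrite /L/= rmorphB sK subrr. Qed.

Let N_nonunits x : ~ N x -> invertible x.
Proof.
move=> Nx; have [u pu] := local_invertible A_local Nx.
have [|v xv] := @L_inv (x * s u - 1).
  by rewrite /L/= rmorphB rmorphM rmorph1 sK pu subrr.
by exists (s u * v); rewrite mulrA -xv addrC subrK.
Qed.

Let N1 : ~ N 1.
Proof. by rewrite /N/= rmorph1; apply/maximal_not1/local_maximal. Qed.

Lemma split_local : local_ring R /\ the_maximal_ideal R = N.
Proof. exact: local_of_nonunits. Qed.

(** Every x in N is s (p x) + (x - s (p x)), where p x is in M and the second
    term is in L. *)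
Lemma split_generators m n : has_generators M m -> has_generators L n ->
  has_generators N (m + n).
Proof.
move=> [g ME] [h LE].
have splitl j : fintype.split (lshift n j) = inl j := unsplitK (inl j).
have splitr j : fintype.split (rshift m j) = inr j := unsplitK (inr j).
pose k i := match fintype.split i with inl j => s (g j) | inr j => h j end.
exists k; apply/seteqP; split=> [x Nx|_ [c ->]].
  have : M (p x) by [].
  rewrite ME => -[c pxE].
  have := L_split x; rewrite {1}LE => -[d dE].
  exists (fun i => match fintype.split i with inl j => s (c j) | inr j => d j end).
  rewrite big_split_ord/= -[x in LHS](subrK (s (p x))) dE pxE rmorph_sum [LHS]addrC.
  congr +%R; apply: eq_bigr => i _; rewrite /k.
    by rewrite splitl rmorphM.
  by rewrite splitr.
apply: ideal_sum => // i _; apply: idealMl => //; rewrite /k.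
case: fintype.split => j; last by apply: LN; rewrite LE; apply: generated_mem.
by rewrite /N/= sK ME; apply: generated_mem.
Qed.

(** Among n generators of N, those indexed by a smallest S whose images generate
    M account for M, and the n - #|S| others, corrected into L, account for L by
    Nakayama's lemma. *)
Lemma split_generators_ge n : finitely_generated L -> has_generators N n ->
  exists m k, [/\ has_generators M m, has_generators L k & n = (m + k)%N].
Proof.
move=> Lfg /has_generators_spanned[g [Ng gN]].
have Mg : spanned M (p \o g) [set: _]%SET.
  split=> [i iT|x Mx]; first exact: Ng.
  have /gN[c xE] : N (s x) by rewrite /N/= sK.
  exists (p \o c); rewrite -(sK x) xE rmorph_sum.
  by apply: eq_bigr => i _; rewrite rmorphM.
have [S gS Sirr] := irredundant_subfamily Mg.
exists #|S|, #|~: S|; split; last by rewrite cardsC card_ord.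
  exact: spanned_has_generators gS.
have [_ gM] := gS.
have [d dE] := choice (fun i => gM _ (Ng i (finset.in_setT i))).
pose g' i := g i - \sum_(k in S) s (d i k) * g k.
have Lg' i : L (g' i).
  rewrite /L/= rmorphB rmorph_sum (dE i); apply/eqP; rewrite subr_eq0; apply/eqP.
  by apply: eq_bigr => k _; rewrite rmorphM sK.
pose H := combinations g' (mem (~: S)).
have idH : is_ideal H := combinations_is_ideal g' _.
apply: (@spanned_has_generators _ _ _ g') => //; split=> // x Lx.
suff LH : L `<=` H by exact: LH.
apply: (nakayama idH idN _ Lfg) => [q Nq|K idK HK NLK l Ll {x Lx}].
  by apply: N_nonunits => Nq1; apply: N1; rewrite -(subrK q 1); apply: idealD.
have [c lE] := gN _ (LN Ll).
pose e k := c k + \sum_(i in ~: S) c i * s (d i k).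
(* Substituting g i = g' i + (its correction) for i outside S. *)
have {}lE : l = \sum_(k in S) e k * g k + \sum_(i in ~: S) c i * g' i.
  have -> : \sum_(k in S) e k * g k = \sum_(k in S) c k * g k +
      \sum_(i in ~: S) c i * \sum_(k in S) s (d i k) * g k.
    under eq_bigr do rewrite mulrDl mulr_suml.
    rewrite big_split/= exchange_big/=; congr +%R; apply: eq_bigr => i _.
    by rewrite mulr_sumr; apply: eq_bigr => k _; rewrite mulrA.
  rewrite -addrA -big_split/= lE.
  under [X in _ = _ + X]eq_bigr do rewrite -mulrDr addrC subrK.
  rewrite (bigID (mem S))/=; congr +%R; apply: eq_bigl => i.
    by rewrite finset.in_setT.
  by rewrite !inE.
have e0 : \sum_(k in S) p (e k) * p (g k) = 0.
  have : p l = 0 by [].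
  rewrite lE rmorphD !rmorph_sum/= [X in _ + X]big1 => [|i _]; last first.
    by rewrite rmorphM (Lg' i : p (g' i) = 0) mulr0.
  by rewrite addr0 => pl; rewrite -[RHS]pl; apply: eq_bigr => k _; rewrite rmorphM.
have Ne k : k \in S -> N (e k).
  move=> kS; apply: contrapT => /(local_invertible A_local).
  exact: (Sirr (p \o e)).
rewrite lE; apply: idealD => //; last by apply: HK; exists c.
(* Subtract s applied to e0, which is 0, and factor
   e g - s (p e) s (p g) = e (g - s (p g)) + s (p g) (e - s (p e)): each product
   has one factor in N and the other in L. *)
have -> : \sum_(k in S) e k * g k =
    \sum_(k in S) (e k * (g k - s (p (g k))) + s (p (g k)) * (e k - s (p (e k)))).
  transitivity (\sum_(k in S) e k * g k - s (\sum_(k in S) p (e k) * p (g k))).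
    by rewrite e0 rmorph0 subr0.
  rewrite rmorph_sum -sumrB; apply: eq_bigr => k _.
  by rewrite !mulrBr addrA rmorphM (mulrC (s (p (g k))) (e k)) subrK mulrC
    (mulrC (s (p (g k)))).
apply: ideal_sum => // k kS; apply: idealD => //.
  by apply: NLK; [exact: Ne | exact: L_split].
apply: NLK; last exact: L_split.
by rewrite /N/= sK; apply: Ng; rewrite finset.in_setT.
Qed.

Lemma split_embdim : finitely_generated M -> finitely_generated L ->
  [/\ local_ring R, finitely_generated (the_maximal_ideal R) &
      embdim R = (embdim A + min_generators L)%N].
Proof.
move=> Mfg Lfg; have [locR RN] := split_local.
have [Mgen Mmin] := min_generatorsP Mfg.
have [Lgen Lmin] := min_generatorsP Lfg.
have Ngen := split_generators Mgen Lgen.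
split=> //; first by rewrite RN; eexists; exact: Ngen.
rewrite /embdim RN; apply: min_generatorsE Ngen _ => n.
move=> /(split_generators_ge Lfg)[m [k [Mm Lk ->]]].
by apply: leq_add; [exact: Mmin | exact: Lmin].
Qed.

End SplitExtension.

(** * The amalgamation as a split extension *)

Section AmalgamMaps.
Variables (A B : comPzRingType) (f : {rmorphism A -> B}) (J : ideal B).

Definition amalg_fst (x : amalg f J) : A := (amalg_val x).1.

Fact amalg_fst_zmod_morphism : zmod_morphism amalg_fst.
Proof. by []. Qed.
Fact amalg_fst_monoid_morphism : monoid_morphism amalg_fst.
Proof. by []. Qed.
HB.instance Definition _ :=
  GRing.isZmodMorphism.Build _ _ amalg_fst amalg_fst_zmod_morphism.
HB.instance Definition _ :=
  GRing.isMonoidMorphism.Build _ _ amalg_fst amalg_fst_monoid_morphism.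

Fact amalg_snd_subproof (x : amalg f J) :
  (amalg_val x).2 \in image_add_pred f J.
Proof.
case: x => x /= /set_mem[a [j [Jj ->]]].
by apply/mem_set; exists a, j.
Qed.

Definition amalg_snd (x : amalg f J) : image_add f J :=
  ImageAdd (amalg_snd_subproof x).

Fact amalg_snd_zmod_morphism : zmod_morphism amalg_snd.
Proof. by move=> x y; apply: val_inj. Qed.
Fact amalg_snd_monoid_morphism : monoid_morphism amalg_snd.
Proof. by split=> [|x y]; apply: val_inj. Qed.
HB.instance Definition _ :=
  GRing.isZmodMorphism.Build _ _ amalg_snd amalg_snd_zmod_morphism.
HB.instance Definition _ :=
  GRing.isMonoidMorphism.Build _ _ amalg_snd amalg_snd_monoid_morphism.

Fact amalg_mem a j : (J : set B) j -> (a, f a + j) \in amalg_pred f J.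
Proof. by move=> Jj; apply/mem_set; exists a, j. Qed.

Definition amalg_diag (a : A) : amalg f J :=
  Amalg (amalg_mem a (ideal0 (idealP J))).

Fact amalg_diag_zmod_morphism : zmod_morphism amalg_diag.
Proof.
by move=> x y; apply: val_inj; congr pair; rewrite /= !addr0 rmorphB.
Qed.
Fact amalg_diag_monoid_morphism : monoid_morphism amalg_diag.
Proof.
by split=> [|x y]; apply: val_inj; congr pair;
  rewrite /= !addr0 ?rmorph1 ?rmorphM.
Qed.
HB.instance Definition _ :=
  GRing.isZmodMorphism.Build _ _ amalg_diag amalg_diag_zmod_morphism.
HB.instance Definition _ :=
  GRing.isMonoidMorphism.Build _ _ amalg_diag amalg_diag_monoid_morphism.

Lemma amalg_diagK : cancel amalg_diag amalg_fst.
Proof. by []. Qed.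

Lemma amalg_snd_surj y : exists x, amalg_snd x = y.
Proof.
case: y => y Hy; have [a [j [Jj yE]]] := set_mem Hy.
by exists (Amalg (amalg_mem a Jj)); apply: val_inj.
Qed.

Lemma amalg_fst_eq0 (x : amalg f J) : amalg_fst x = 0 ->
  (J : set B) (amalg_val x).2.
Proof.
case: x => x Hx; have [a [j [Jj xE]]] := set_mem Hx.
by rewrite /amalg_fst/= xE/= => ->; rewrite rmorph0 add0r.
Qed.

Lemma amalg_snd_ker :
  ideal_in_image_add f J = amalg_snd @` [set x | amalg_fst x = 0].
Proof.
apply/seteqP; split=> [y Jy|_ [x /amalg_fst_eq0 Jx <-] //].
exists (Amalg (amalg_mem 0 Jy)) => //.
by apply: val_inj; rewrite /= rmorph0 add0r.
Qed.

Lemma amalg_snd_ker_inj x : amalg_fst x = 0 -> amalg_snd x = 0 -> x = 0.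
Proof.
move=> x1 /(congr1 val) x2; apply: val_inj.
by rewrite [LHS]surjective_pairing; congr pair.
Qed.

(** If y is the inverse of 1 + j in B, then (1, y) is again in the amalgamation,
    because y = f 1 - j y. *)
Lemma amalg_ker_invertible x : (J : set B) `<=` jacobson_radical B ->
  amalg_fst x = 0 -> invertible (1 + x).
Proof.
move=> Jrad x1; have Jx := amalg_fst_eq0 x1.
have [y xy] := jacobson_invertible (Jrad _ Jx).
have idJ := idealP J.
exists (Amalg (amalg_mem 1 (idealN idJ (idealMr y idJ Jx)))).
apply: val_inj; rewrite [LHS]surjective_pairing; congr pair => /=.
  by rewrite -/(amalg_fst x) x1 addr0 mulr1.
have -> : f 1 - (amalg_val x).2 * y = y.
  by rewrite rmorph1 -[X in X - _]xy mulrDl mul1r addrK.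
exact: xy.
Qed.

End AmalgamMaps.

Theorem proposition6p2 (A B : comPzRingType) (f : {rmorphism A -> B})
    (J : ideal B)
    (A_local : local_ring A)
    (M_fg : finitely_generated (the_maximal_ideal A))
    (J_fg : finitely_generated (ideal_in_image_add f J))
    (J_jacobson : (J : set B) `<=` jacobson_radical B) :
  [/\ local_ring (amalg f J),
      finitely_generated (the_maximal_ideal (amalg f J)) &
      embdim (amalg f J) =
        (embdim A + min_generators (ideal_in_image_add f J))%N].
Proof.
pose L := [set x : amalg f J | amalg_fst x = 0].
have LJ n : has_generators L n <-> has_generators (ideal_in_image_add f J) n.
  apply: (@has_generators_transport _ _ (@amalg_snd A B f J)).
  - exact: amalg_snd_surj.
  - exact: (kernel_is_ideal (@amalg_fst A B f J)).
  - exact: amalg_snd_ker.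
  - exact: amalg_snd_ker_inj.
have Lfg : finitely_generated L by have [n Jn] := J_fg; exists n; apply/LJ.
have -> : min_generators (ideal_in_image_add f J) = min_generators L.
  have [Lgen Lmin] := min_generatorsP Lfg.
  by apply: min_generatorsE => [|m /LJ]; [apply/LJ | exact: Lmin].
apply: (split_embdim (@amalg_diagK A B f J)) => // x.
exact: amalg_ker_invertible.
Qed.
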